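(* Let $r,n\ge1$ be integers and $c,d\in\mathbb{Z}$, and put $\mathscr{d}_1=\gcd(c-d,n)$, $\mathscr{d}_2=\gcd(c+(r-1)d,n)$. Let $S_{coroot}(c,d,r,n)$ be the number of $\boldsymbol{x}=(x_1,\dots,x_r)\in(\mathbb{Z}/n\mathbb{Z})^r$ satisfying the system \[(c-d)(x_i-x_r)\equiv 0\pmod n\ \text{ for all } i\in\{1,\dots,r-1\},\qquad (c+(r-1)d)(x_1+\cdots+x_r)\equiv 0\pmod n.\] Then \[S_{coroot}(c,d,r,n)=\mathscr{d}_1^{\,r-1}\,\mathscr{d}_2\,\gcd\left(\frac{n}{\mathscr{d}_1},\frac{n}{\mathscr{d}_2},r\right).\] *)

(* Defs.v *)
From mathcomp Require Import all_boot all_order all_algebra.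

Set Implicit Arguments.
Unset Strict Implicit.
Unset Printing Implicit Defensive.

Import GRing.Theory.
Local Open Scope ring_scope.

(* Z/nZ for n >= 1, as an additive group ('I_m.+1 carries addition modulo    *)
(* m.+1).  'Z_n is not usable because 'Z_1 is Z/2Z.  An integer k acts on    *)
(* u : Zmod n by u *~ k.                                                     *)
Notation Zmod n := ('I_n.-1.+1) (only parsing).

(* For r >= 1, 'I_r.-1.+1 is {0, .., r-1}: x_i is x at index i - 1, and  *)
(* x_r is x ord_max.                                                         *)
Definition coroot_system (c d : int) (r n : nat)
    (x : {ffun 'I_r.-1.+1 -> Zmod n}) : bool :=
  [forall i : 'I_r.-1.+1, (i < r.-1)%N ==>
     ((x i - x ord_max) *~ (c - d) == 0)]
  && ((\sum_(i < r.-1.+1) x i) *~ (c + (r%:Z - 1) * d) == 0).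

Definition S_coroot (c d : int) (r n : nat) : nat :=
  #|[set x : {ffun 'I_r.-1.+1 -> Zmod n} | coroot_system c d x]|.

(* Main.v *)
(** Put a = c - d, b = c + (r-1)d, e = n/gcd(a,n), e' = n/gcd(b,n).  The
    solutions of a (x_i - x_r) = 0 form a subgroup A of (Z/n)^r with
    n gcd(a,n)^(r-1) elements: the differences x_i - x_r range freely over the
    a-torsion, which is the set of multiples of e.  On A the sum of coordinates
    equals r x_r + sum_i (x_i - x_r), so the sum maps A onto the multiples of
    q = gcd(r,e), with all fibres of size |A| / (n/q) = gcd(a,n)^(r-1) q.  The
    last equation asks the sum to be a multiple of e', leaving the multiples of
    lcm(q,e') as possible values, n / lcm(q,e') = gcd(b,n) gcd(q,e') / q many. *)
From HB Require Import structures.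
Require Import Defs.
From mathcomp Require Import all_boot all_order all_algebra.

Import GRing.Theory.
Local Open Scope ring_scope.

(** Makes the solution tuples a [finZmodType], as [card_preim_additive] requires. *)
HB.instance Definition _ (aT : finType) (rT : finZmodType) :=
  Finite.on {ffun aT -> rT}.

Section Residues.

Variable m : nat.

(* 'I_1 is not a ring in MathComp, so z%:~R is not available for all m. *)
Definition residue (z : int) : 'I_m.+1 := inZp 1 *~ z.

Fact residue_is_zmod_morphism : zmod_morphism residue.
Proof. by move=> y z; rewrite /residue mulrzBr. Qed.

HB.instance Definition _ :=
  GRing.isZmodMorphism.Build int 'I_m.+1 residue residue_is_zmod_morphism.

Lemma residueE z : (residue z : nat)%:Z = (z %% m.+1%:Z)%Z.
Proof.
have resn (k : nat) : residue k = inZp k.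
  by rewrite /residue -pmulrn Zp_mulrn; apply: val_inj => /=; rewrite modnMml mul1n.
(* The modulus maps to 0, so [z] may be replaced by its remainder, a natural number to which [resn]
   applies. *)
have -> : residue z = residue (z %% m.+1%:Z)%Z.
  rewrite {1}(divz_eq z m.+1) /residue mulrzDr [_ * Posz _]mulrC mulrzA.
  rewrite -/(residue m.+1) resn.
  have -> : inZp m.+1 = 0 :> 'I_m.+1 by apply: val_inj; rewrite /= modnn.
  by rewrite mul0rz add0r.
have /gez0_abs <- : (0 <= z %% m.+1%:Z)%Z by exact: modz_ge0.
rewrite resn /= modn_small // -ltz_nat gez0_abs ?modz_ge0 //.
exact: ltz_pmod.
Qed.

Lemma residue_val (u : 'I_m.+1) : residue (u : nat)%:Z = u.
Proof.
apply/val_inj/eqP; rewrite -eqz_nat residueE modz_nat modn_small //; exact/eqP.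
Qed.

Lemma residue_eq0 z : (residue z == 0) = (m.+1%:Z %| z)%Z.
Proof. by rewrite -val_eqE /= -eqz_nat residueE; exact/eqP/dvdz_mod0P. Qed.

(** Reduction changes [z] by a multiple of the modulus, hence of [g]. Divisibility in Z/n can thus
    be tested on integer lifts. *)
Lemma dvdn_residue (g : nat) z :
  (g %| m.+1)%N -> (g %| residue z)%N = (g%:Z %| z)%Z.
Proof.
move=> gm; have -> : (g %| residue z)%N = (g%:Z %| (residue z : nat)%:Z)%Z by [].
have gz : (g%:Z %| (z %/ m.+1%:Z)%Z * m.+1%:Z)%Z by exact: dvdz_mull.
by rewrite residueE [in RHS](divz_eq z m.+1%:Z) (rpredDl _ gz).
Qed.

(** With n the modulus, n always divides u n, so n divides u a exactly when it divides u
    gcd(a,n). *)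
Lemma mulrz_eq0_dvdn (u : 'I_m.+1) (a : int) :
  (u *~ a == 0) = (m.+1 %/ gcdn `|a| m.+1 %| u)%N.
Proof.
rewrite dvdn_divLR ?gcdn_gt0 ?orbT ?dvdn_gcdr // muln_gcdr dvdn_gcd.
rewrite [X in _ && X]dvdn_mull // andbT -{1}(residue_val u) /residue -mulrzA.
by rewrite -/(residue _) residue_eq0 dvdzE abszM.
Qed.

Lemma card_dvdn_ord (g : nat) :
  (g %| m.+1)%N -> #|[set u : 'I_m.+1 | (g %| u)%N]| = (m.+1 %/ g)%N.
Proof.
move=> gm; have g_gt0 : (0 < g)%N by apply: dvdn_gt0 gm.
have ltgm (i : 'I_(m.+1 %/ g)) : (i * g < m.+1)%N by rewrite -ltn_divRL.
rewrite -[RHS]card_ord -(card_imset predT (f := fun i => Ordinal (ltgm i))).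
  apply: eq_card => u; rewrite inE; apply/idP/imsetP => [gu|[i _ ->]]; last first.
    exact: dvdn_mull.
  have ltu : (u %/ g < m.+1 %/ g)%N by rewrite ltn_divRL // divnK.
  by exists (Ordinal ltu) => //; apply: val_inj; rewrite /= divnK.
move=> i j /(congr1 val) /= /eqP; rewrite eqn_pmul2r // => /eqP; exact: val_inj.
Qed.

Lemma card_mulrz_eq0 (a : int) :
  #|[set u : 'I_m.+1 | u *~ a == 0]| = gcdn `|a| m.+1.
Proof.
have g_dvd : (gcdn `|a| m.+1 %| m.+1)%N by exact: dvdn_gcdr.
rewrite (eq_finset _ (fun u => mulrz_eq0_dvdn u a)) card_dvdn_ord ?dvdn_div //.
rewrite -{1}(divnK g_dvd) mulKn //.
by rewrite divn_gt0 ?(dvdn_leq _ g_dvd) // gcdn_gt0 orbT.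
Qed.

End Residues.

(** Each nonempty fibre of [f] on [A] is a translate of the kernel of [f] on [A]; subtracting a
    chosen preimage [z] carries the fibre to that kernel. *)
Lemma card_preim_additive (U V : finZmodType) (f : U -> V)
    (A : {set U}) (B : {set V}) :
    zmod_closed A -> zmod_morphism f ->
  #|[set x in A | f x \in B]|
    = (#|[set x in A | f x == 0%R]| * #|B :&: [set f x | x in A]|)%N.
Proof.
move=> [A0 AB] fB.
have AD x y : x \in A -> y \in A -> x + y \in A.
  by move=> Ax Ay; rewrite -[y]opprK AB // -[- y]add0r AB.
rewrite -sum1_card (partition_big f [in B :&: [set f x | x in A]]) /=; last first.
  by move=> x; rewrite !inE => /andP[Ax ->]; rewrite imset_f.
rewrite mulnC -sum_nat_const; apply: eq_bigr => v.
rewrite inE => /andP[Bv /imsetP[z Az def_v]].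
rewrite sum1_card -(card_imset _ (addIr (- z))); apply: eq_card => x.
apply/imsetP/idP => [[y]|].
  rewrite unfold_in !inE => /andP[/andP[Ay _] /eqP fy] ->.
  by rewrite AB //= fB fy def_v subrr.
rewrite inE => /andP[Ax /eqP fx]; exists (x + z); last by rewrite addrK.
have fxz : f (x + z) = v.
  by apply/(addIr (- f z)); rewrite -fB addrK fx def_v subrr.
by rewrite unfold_in inE fxz AD // Bv eqxx.
Qed.

Section DifferenceSystem.

Variables (m s : nat) (a : int).

Definition difference_kernel : {set {ffun 'I_s.+1 -> 'I_m.+1}} :=
  [set x : {ffun 'I_s.+1 -> 'I_m.+1} | [forall i, (x i - x ord_max) *~ a == 0]].

Lemma difference_kernelP (x : {ffun 'I_s.+1 -> 'I_m.+1}) :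
  reflect (forall i, (x i - x ord_max) *~ a = 0) (x \in difference_kernel).
Proof. by rewrite inE; apply: (iffP forallP) => H i; apply/eqP. Qed.

Lemma difference_kernel_zmod_closed : zmod_closed difference_kernel.
Proof.
split=> [|x y /difference_kernelP Ax /difference_kernelP Ay];
  apply/difference_kernelP => i; first by rewrite !ffunE subrr mul0rz.
by rewrite !ffunE opprD addrACA -opprD mulrzDl Ax mulNrz Ay subr0.
Qed.

Lemma card_difference_kernel :
  #|difference_kernel| = (m.+1 * gcdn `|a| m.+1 ^ s)%N.
Proof.
(* In the coordinates x_r and x_i - x_r the solutions form a product: any value at [ord_max],
   [a]-torsion elsewhere. [shift] returns to the original coordinates. *)
pose F (i : 'I_s.+1) : pred 'I_m.+1 :=
  fun u => (i == ord_max) || (u *~ a == 0).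
pose shift (x : {ffun 'I_s.+1 -> 'I_m.+1}) : {ffun 'I_s.+1 -> 'I_m.+1} :=
  [ffun i => if i == ord_max then x i else x i + x ord_max].
have shift_inj : injective shift.
  move=> x y /ffunP e; have emax : x ord_max = y ord_max.
    by have := e ord_max; rewrite !ffunE eqxx.
  apply/ffunP => i; have := e i; rewrite !ffunE emax.
  by case: eqP => // _; apply: addIr.
have -> : difference_kernel = shift @: [set x in family F].
  apply/setP => x; apply/difference_kernelP/imsetP => [Ax|[y Fy ->] i].
    exists [ffun i => if i == ord_max then x i else x i - x ord_max].
      rewrite inE; apply/familyP => i; rewrite ffunE unfold_in /=.
      by case: eqP => //= _; apply/eqP.
    by apply/ffunP => i; rewrite !ffunE eqxx; case: eqP => // _; rewrite subrK.
  rewrite !ffunE eqxx; case: eqP => [->|/eqP/negPf ne]; first by rewrite subrr mul0rz.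
  rewrite addrK; move: Fy; rewrite inE => /familyP/(_ i).
  by rewrite unfold_in /= ne => /eqP.
rewrite card_imset // cardsE card_family foldrE big_map big_enum /=.
rewrite (bigD1 ord_max) //=; congr (_ * _)%N.
  by rewrite -[RHS]card_ord; apply: eq_card => u; rewrite unfold_in /= eqxx.
rewrite (eq_bigr (fun=> gcdn `|a| m.+1)) => [|i /negPf ne].
  by rewrite prod_nat_const cardC1 card_ord.
by rewrite -card_mulrz_eq0 cardsE; apply: eq_card => u; rewrite unfold_in /= ne.
Qed.

Lemma sum_difference_kernel (q := gcdn s.+1 (m.+1 %/ gcdn `|a| m.+1)) :
  [set \sum_i x i | x : {ffun 'I_s.+1 -> 'I_m.+1} in difference_kernel]
    = [set u : 'I_m.+1 | (q %| u)%N].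
Proof.
pose e := (m.+1 %/ gcdn `|a| m.+1)%N.
have em : (e %| m.+1)%N by rewrite dvdn_div // dvdn_gcdr.
have qm : (q %| m.+1)%N by apply: dvdn_trans em; apply: dvdn_gcdr.
have dvdq (u : 'I_m.+1) : (m.+1 %/ gcdn `|a| m.+1 %| u)%N -> (q%:Z %| u%:Z)%Z.
  by apply: dvdn_trans; apply: dvdn_gcdr.
apply/setP => u; rewrite inE; apply/imsetP/idP => [[x /difference_kernelP Ax ->]|].
  (* An integer lift of the sum whose terms are visibly multiples of [q]: the differences through
     [e], the last term through its factor r. *)
  have -> : \sum_i x i = residue m (\sum_i (nat_of_ord (x i - x ord_max)%R)%:Z
                                   + (x ord_max : nat)%:Z *~ s.+1).
    rewrite raddfD raddf_sum raddfMz /= residue_val.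
    rewrite (eq_bigr _ (fun i _ => residue_val m (x i - x ord_max))).
    by rewrite sumrB sumr_const card_ord -pmulrn subrK.
  rewrite dvdn_residue //; apply: rpredD.
    by apply: rpred_sum => i _; apply: dvdq; rewrite -mulrz_eq0_dvdn Ax.
  by rewrite -mulrzr intz; apply: dvdz_mull; apply: (dvdn_gcdl s.+1 e).
(* If s = 0 then ord0 = ord_max, but the witness below still works: its
   coordinates always differ by multiples of e. *)
have [y [z yz]] := Bezoutz s.+1 e.
case/dvdnP => k def_u.
(* All coordinates are y k, with z e k added to one of them, so the sum is (y r + z e) k = q k =
   u. *)
pose x : {ffun 'I_s.+1 -> 'I_m.+1} :=
  [ffun i => residue m ((y + z * e *+ (i == ord0)) * k)].
exists x.
  apply/difference_kernelP => i; apply/eqP.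
  rewrite mulrz_eq0_dvdn !ffunE -raddfB dvdn_residue //.
  rewrite -mulrBl opprD addrACA subrr add0r dvdz_mulr //.
  by apply: rpredB; apply: rpredMn; apply: dvdz_mull.
under eq_bigr => i _ do rewrite ffunE.
rewrite -raddf_sum -mulr_suml big_split /= sumr_const card_ord.
rewrite (bigD1 ord0) //= big1 => [|i /negPf ->]; last by rewrite mulr0n.
rewrite addr0 mulr1n -mulr_natr natz yz.
by rewrite -[u]residue_val def_u PoszM mulrC.
Qed.

Lemma card_sum_difference_kernel (b : int)
    (e := (m.+1 %/ gcdn `|a| m.+1)%N) (e' := (m.+1 %/ gcdn `|b| m.+1)%N) :
  #|[set x in difference_kernel | (\sum_i x i) *~ b == 0]|
    = (gcdn `|a| m.+1 ^ s * gcdn `|b| m.+1 * gcdn (gcdn e e') s.+1)%N.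
Proof.
set q := gcdn s.+1 e.
have em : (e %| m.+1)%N by rewrite dvdn_div // dvdn_gcdr.
have e'm : (e' %| m.+1)%N by rewrite dvdn_div // dvdn_gcdr.
have qm : (q %| m.+1)%N by apply: dvdn_trans em; apply: dvdn_gcdr.
have sumB : zmod_morphism (fun x : {ffun 'I_s.+1 -> 'I_m.+1} => \sum_i x i).
  by move=> x y; rewrite -sumrB; apply: eq_bigr => i _; rewrite !ffunE.
have fibers B := @card_preim_additive _ _ _ _ B difference_kernel_zmod_closed sumB.
pose K := #|[set x in difference_kernel | \sum_i x i == 0]|.
(* The fibre count with the whole group as target determines [K]; with the [b]-torsion as target it
   gives the desired count. *)
have cardK : (m.+1 * gcdn `|a| m.+1 ^ s = K * (m.+1 %/ q))%N.
  rewrite -card_difference_kernel -card_dvdn_ord // -sum_difference_kernel.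
  rewrite -[X in (K * #|pred_of_set X|)%N]setTI.
  etransitivity; last exact: (fibers setT).
  by apply: eq_card => x; rewrite !inE andbT.
have -> : #|[set x in difference_kernel | (\sum_i x i) *~ b == 0]|
          = (K * (m.+1 %/ lcmn q e'))%N.
  rewrite -card_dvdn_ord ?dvdn_lcm ?qm //.
  have -> : [set u : 'I_m.+1 | (lcmn q e' %| u)%N]
      = [set u | u *~ b == 0] :&: [set u : 'I_m.+1 | (q %| u)%N].
    by apply/setP => u; rewrite !inE mulrz_eq0_dvdn dvdn_lcm andbC.
  rewrite -sum_difference_kernel.
  etransitivity; last exact: (fibers [set u | u *~ b == 0]).
  by apply: eq_card => x; rewrite !inE.
have q_gt0 : (0 < q)%N by apply: dvdn_gt0 qm.
have e'_gt0 : (0 < e')%N by apply: dvdn_gt0 e'm.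
have -> : K = (gcdn `|a| m.+1 ^ s * q)%N.
  have mq_gt0 : (0 < m.+1 %/ q)%N by rewrite divn_gt0 // dvdn_leq.
  apply/eqP; rewrite -(eqn_pmul2r mq_gt0) -cardK -mulnA [(q * _)%N]mulnC.
  by rewrite divnK // mulnC.
have lcm_dvd : (lcmn q e' %| m.+1)%N by rewrite dvdn_lcm qm.
have -> : gcdn (gcdn e e') s.+1 = gcdn q e' by rewrite /q gcdnC gcdnA.
have e'E : (e' * gcdn `|b| m.+1 = m.+1)%N by rewrite divnK ?dvdn_gcdr.
rewrite -!mulnA; congr (_ * _)%N.
(* Multiplying by this factor clears the quotient: both sides become n q e', the right one through
   gcd(q,e') lcm(q,e') = q e'. *)
have le_gt0 : (0 < lcmn q e' * e')%N by rewrite muln_gt0 lcmn_gt0 q_gt0 e'_gt0.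
apply/eqP; rewrite -(eqn_pmul2r le_gt0); apply/eqP.
rewrite mulnA -[(q * _ * lcmn q e')%N]mulnA divnK //.
rewrite -{1}e'E [(lcmn q e' * e')%N]mulnC mulnACA [(gcdn q e' * _)%N]mulnC.
by rewrite muln_lcm_gcd [RHS]mulnA [(_ * q)%N in RHS]mulnC [(e' * gcdn _ _)%N]mulnC.
Qed.

End DifferenceSystem.

Theorem theorem5p3 (r n : nat) (c d : int) (hr : (1 <= r)%N) (hn : (1 <= n)%N) :
  let d1 : int := gcdz (c - d) n%:Z in
  let d2 : int := gcdz (c + (r%:Z - 1) * d) n%:Z in
  (S_coroot c d r n)%:Z =
    d1 ^+ r.-1 * d2 *
    gcdz (gcdz (n%:Z %/ d1)%Z (n%:Z %/ d2)%Z) r%:Z.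
Proof.
case: r n hr hn => [|s] [|m] // _ _ /=.
have -> : S_coroot c d s.+1 m.+1 =
    #|[set x in difference_kernel m s (c - d) |
        (\sum_i x i) *~ (c + (s.+1%:Z - 1) * d) == 0]|.
  apply: eq_card => x; rewrite !inE /coroot_system /=; congr (_ && _).
  (* The one index outside the range of the system is [ord_max], where the difference is 0. *)
  apply: eq_forallb => i; case: ltnP => //= si.
  have -> : i = ord_max by apply: val_inj; apply/eqP; rewrite eqn_leq si -ltnS ltn_ord.
  by rewrite subrr mul0rz eqxx.
by rewrite card_sum_difference_kernel !PoszM /gcdz !divz_nat
  -[Posz (_ ^ _)]natz natrX natz.
Qed.
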